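(* Consider ack-only distributed algorithms for the wireless scheduling problem in the SINR model in which all senders start at the same time in the same state and run an identical (possibly randomized) algorithm. No such algorithm approximates the scheduling problem by a factor better than $\Omega(\log n)$, even when acknowledgements are free: for such an algorithm there are instances $L$ with arbitrarily large number of links $n$ on which the expected number of slots until all links have succeeded is $\Omega(\log n)\cdot T(L)$.
   Context: A link $\ell_v$ is a pair (sender $s_v$, receiver $r_v$) of points in a metric space with distance $d$; its length is $\ell_v=d(s_v,r_v)$, and $d_{wv}=d(s_w,r_v)$. Each link transmits with power $P_v$; parameters $\alpha>0$, $\beta\ge1$, noise $N\ge0$. A set $S$ of simultaneously transmitting links is feasible if every $\ell_v\in S$ satisfies $\frac{P_v/\ell_v^\alpha}{\sum_{\ell_w\in S\setminus\{\ell_v\}}P_w/d_{wv}^\alpha+N}\ge\beta$; a link succeeds in a slot iff this inequality holds for it with respect to the links transmitting in that slot. The scheduling number $T(L)$ is the minimum number of feasible sets partitioning $L$. An ack-only distributed algorithm: senders know an estimate of $n$, have synchronized clocks, use a given fixed power assignment, and the only external information a sender receives is an acknowledgement when its transmission has succeeded; free acknowledgements means these acknowledgements are delivered without being scheduled by the algorithm. *)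

(* Defs.v *)
From HB Require Import structures.
From mathcomp Require Import all_boot all_order all_algebra.
From mathcomp Require Import all_classical all_reals all_analysis.

Set Implicit Arguments.
Unset Strict Implicit.
Unset Printing Implicit Defensive.

Import Order.TTheory GRing.Theory Num.Theory.
Import numFieldNormedType.Exports.

Local Open Scope classical_set_scope.
Local Open Scope ring_scope.

Record link_set (R : realType) := LinkSet {
  nlinks : nat ;
  link_space : metricType R ;
  sender : 'I_nlinks -> link_space ;
  receiver : 'I_nlinks -> link_space ;
  sender_neq_receiver : forall v, sender v != receiver v }.

Section sinr.
Context {R : realType} (alpha beta noise : R).
Context (L : link_set R) (power : 'I_(nlinks L) -> R).
Implicit Types (v w : 'I_(nlinks L)) (S : {set 'I_(nlinks L)}).

Definition cross_dist w v : R := mdist (sender w) (receiver v).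

Definition link_length v : R := cross_dist v v.

(* The quotients below are taken in \bar R, where the inverse of 0 is +oo:
   a lone link without noise has SINR +oo, and an interferer located at the
   receiver contributes +oo. *)
Definition received_power w v : \bar R :=
  ((power w)%:E / (cross_dist w v `^ alpha)%:E)%E.

Definition SINR S v : \bar R :=
  (received_power v v /
   (\sum_(w in (S :\ v)%SET) received_power w v + noise%:E))%E.

Definition succeeds S v : bool := (v \in S) && (beta%:E <= SINR S v)%E.

Definition feasible S : bool := [forall v in S, succeeds S v].

Definition feasible_partition (Q : {set {set 'I_(nlinks L)}}) : bool :=
  finset.partition Q [set: 'I_(nlinks L)]%SET && [forall S in Q, feasible S].

Definition is_scheduling_number (k : nat) : Prop :=
  (exists2 Q, feasible_partition Q & #|Q| = k) /\
  (forall Q, feasible_partition Q -> (k <= #|Q|)%N).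

End sinr.

(* A sender's whole randomness is one draw of its private seed (which may
   encode infinitely many coin flips).  Its decision to transmit in slot t is
   a function of the estimate of the number of links, its seed, and the list
   of its acknowledgements in slots 0, ..., t-1, in that order; the clock t is
   the size of that list.  Nothing else about the link is available to it, so
   all senders run the same program from the same initial state. *)
Record algorithm (R : realType) := Algorithm {
  seed_display : measure_display ;
  seed : measurableType seed_display ;
  seed_law : probability seed R ;
  transmit : nat -> seed -> seq bool -> bool ;
  measurable_transmit : forall nhat acks,
    measurable_fun [set: seed] (fun s => transmit nhat s acks) }.

Definition mutually_independent (R : realType) (d d' : measure_display)
    (Omega : measurableType d) (E : measurableType d') (P : probability Omega R)
    (I : finType) (X : I -> Omega -> E) : Prop :=
  forall (J : {set I}) (B : I -> set E), (forall i, measurable (B i)) ->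
    P [set o | forall i, i \in J -> B i (X i o)] =
    (\prod_(i in J) P (X i @^-1` B i))%E.

(* n independent copies of the algorithm's randomness on some probability
   space. *)
Record execution (R : realType) (A : algorithm R) (n : nat) := Execution {
  sample_display : measure_display ;
  sample : measurableType sample_display ;
  sample_prob : probability sample R ;
  seeds : 'I_n -> sample -> seed A ;
  measurable_seeds : forall v, measurable_fun [set: sample] (seeds v) ;
  seeds_law : forall v (B : set (seed A)), measurable B ->
    sample_prob (seeds v @^-1` B) = seed_law A B ;
  seeds_independent : mutually_independent sample_prob seeds }.

Section run.
Context {R : realType} (alpha beta noise : R).
Context (L : link_set R) (power : 'I_(nlinks L) -> R).
Context (A : algorithm R) (nhat : nat).

Definition transmitters (s : 'I_(nlinks L) -> seed A)
    (acks : 'I_(nlinks L) -> seq bool) : {set 'I_(nlinks L)} :=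
  [set v | transmit nhat (s v) (acks v)]%SET.

Fixpoint ack_history (s : 'I_(nlinks L) -> seed A) (t : nat)
    : 'I_(nlinks L) -> seq bool :=
  if t is u.+1 then
    let acks := ack_history s u in
    fun v => rcons (acks v)
      (succeeds alpha beta noise power (transmitters s acks) v)
  else fun=> [::].

Definition all_succeeded (s : 'I_(nlinks L) -> seed A) (t : nat) : bool :=
  [forall v, true \in ack_history s t v].

(* +oo when some link never succeeds. *)
Definition num_slots (s : 'I_(nlinks L) -> seed A) : \bar R :=
  ereal_inf [set t%:R%:E | t in [set t : nat | all_succeeded s t]].

Definition expected_slots (X : execution A (nlinks L)) : \bar R :=
  (\int[sample_prob X]_o num_slots (fun v => seeds v o))%E.

End run.

(* Main.v *)
(** Put [2 ^ k] couples far apart on a line, the two links of a couple joining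
    the same two points in opposite directions.  If both links of a couple
    transmit, each receiver sits on top of an interfering sender and both fail,
    so two slots are necessary; they also suffice, one per direction.

    A sender without success so far has seen only negative acknowledgements, so
    its first [k] decisions are then a word in [{0,1}^k] determined by its seed.
    If the two seeds of a couple give the same word, the links always transmit
    together and none succeeds within [k] slots.  By Cauchy-Schwarz such a
    collision has probability at least [2 ^ -k], hence by independence none
    occurs with probability at most [(1 - 2 ^ -k) ^ (2 ^ k) <= 1/2].  With
    probability at least [1/2] more than [k] slots are needed. *)

Require Import Defs.
From HB Require Import structures.
From mathcomp Require Import all_boot all_order all_algebra.
From mathcomp Require Import all_classical all_reals all_analysis.
From mathcomp Require Import ring lra.

Import Order.TTheory GRing.Theory Num.Theory.
Import numFieldNormedType.Exports.

Local Open Scope classical_set_scope.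
Local Open Scope ring_scope.

(** * Criteria for the failure and success of a single link *)

Section sinr_bounds.
Context {R : realType} {alpha beta noise : R}.
Context {L : link_set R} {power : 'I_(nlinks L) -> R}.
Hypotheses (alpha_gt0 : 0 < alpha) (beta_gt0 : 0 < beta).
Hypotheses (noise_ge0 : 0 <= noise) (power_gt0 : forall v, 0 < power v).
Implicit Types (v w : 'I_(nlinks L)) (S : {set 'I_(nlinks L)}).

Lemma received_power_ge0 w v : (0 <= received_power alpha power w v)%E.
Proof.
apply: mule_ge0; first by rewrite lee_fin ltW.
by rewrite inve_ge0 lee_fin powR_ge0.
Qed.

Lemma received_power_gt0E w v : 0 < cross_dist w v ->
  received_power alpha power w v = (power w / cross_dist w v `^ alpha)%:E.
Proof.
by move=> d0; rewrite /received_power inver gt_eqF ?powR_gt0// EFinM.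
Qed.

(** Since [alpha > 0], the attenuation at distance zero vanishes, so the interference is [+oo] and
    the SINR is 0, below [beta]. *)
Lemma colocated_not_succeeds S v w : w \in S -> w != v ->
  cross_dist w v = 0 -> ~~ succeeds alpha beta noise power S v.
Proof.
move=> wS wv d0; rewrite /succeeds negb_and; apply/orP; right.
rewrite -ltNge /SINR (bigD1 w)/=; last by rewrite !inE wv wS.
have -> : received_power alpha power w v = +oo%E.
  by rewrite /received_power d0 powR0 ?gt_eqF// inve0 gt0_muley// lte_fin.
rewrite -addeA addye; last first.
  rewrite gt_eqF// (lt_le_trans ltNy0)// adde_ge0 ?lee_fin//.
  by apply: sume_ge0 => u _; exact: received_power_ge0.
by rewrite invey mule0 lte_fin.
Qed.

(** The case [y = 0] is that of a lone transmitter without noise, whose SINR is [+oo]. *)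
Lemma lee_divE (x y : R) : 0 < x -> 0 <= y -> beta * y <= x ->
  (beta%:E <= x%:E / y%:E)%E.
Proof.
move=> x0 y0 bxy; rewrite inver; case: eqVneq => [_|yn0].
  by rewrite gt0_muley ?lte_fin// leey.
by rewrite -EFinM lee_fin ler_pdivlMr// lt_neqAle eq_sym yn0.
Qed.

(** The interference is bounded crudely by [e] for every link of [L], transmitting or not, so one
    condition serves all sets [S]. *)
Lemma far_succeeds (e : R) S v : v \in S -> 0 < link_length v ->
  (forall w, w \in S -> w != v ->
     0 < cross_dist w v /\ power w / cross_dist w v `^ alpha <= e) ->
  0 <= e ->
  beta * ((nlinks L)%:R * e + noise) <= power v / link_length v `^ alpha ->
  succeeds alpha beta noise power S v.
Proof.
move=> vS l0 far e0 be; rewrite /succeeds vS/= /SINR.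
rewrite received_power_gt0E//.
rewrite (eq_bigr (fun w => (power w / cross_dist w v `^ alpha)%:E)); last first.
  move=> w; rewrite !inE => /andP[wv wS].
  by rewrite received_power_gt0E//; case: (far w wS wv).
rewrite sumEFin -EFinD; apply: lee_divE.
- by rewrite divr_gt0 ?power_gt0// powR_gt0.
- rewrite addr_ge0//; apply: sumr_ge0 => w _.
  by rewrite divr_ge0 ?powR_ge0// ltW.
- apply: le_trans be; rewrite ler_pM2l// lerD2r.
  rewrite -[X in X%:R]card_ord mulr_natl -sumr_const.
  rewrite [leRHS](bigID (mem (S :\ v)%SET))/=.
  apply: ler_wpDr; first by apply: sumr_ge0.
  rewrite [leRHS](eq_bigl (mem (S :\ v)%SET)); last by [].
  apply: ler_sum => w; rewrite !inE => /andP[wv wS].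
  by case: (far w wS wv).
Qed.

End sinr_bounds.

(** * Geometry of the couples on the real line *)

Section couples.
Context {R : realType}.
Variables (m : nat) (len gap : R).
Hypotheses (len_gt0 : 0 < len) (gap_gt0 : 0 < gap).

(** Links [i] and [m + i] form couple [i], so that [big_split_ord] turns a product over links into
    one over couples. *)
Definition couple (v : 'I_(m + m)) : 'I_m :=
  match fintype.split v with inl i => i | inr i => i end.

Definition orientation (v : 'I_(m + m)) : bool := is_inl (fintype.split v).

Definition link_of (i : 'I_m) (b : bool) : 'I_(m + m) :=
  unsplit (if b then inl i else inr i).

Lemma coupleK i b : couple (link_of i b) = i.
Proof. by rewrite /couple /link_of unsplitK; case: b. Qed.

Lemma orientationK i b : orientation (link_of i b) = b.
Proof. by rewrite /orientation /link_of unsplitK; case: b. Qed.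

Lemma link_ofK v : link_of (couple v) (orientation v) = v.
Proof.
rewrite /link_of /couple /orientation -[RHS]splitK.
by case: (fintype.split v).
Qed.

Definition partner v := link_of (couple v) (~~ orientation v).

Lemma couple_partner v : couple (partner v) = couple v.
Proof. exact: coupleK. Qed.

Lemma orientation_partner v : orientation (partner v) = ~~ orientation v.
Proof. exact: orientationK. Qed.

Lemma partnerK : involutive partner.
Proof.
by move=> v; rewrite {1}/partner coupleK orientationK negbK link_ofK.
Qed.

Lemma partner_neq v : partner v != v.
Proof.
apply/eqP => /(congr1 orientation); rewrite orientation_partner.
by case: (orientation v).
Qed.

Lemma same_couple v w : couple w = couple v -> w = v \/ w = partner v.
Proof.
move=> wv; rewrite -(link_ofK w) wv.
have [->|neq] := eqVneq (orientation w) (orientation v).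
  by left; rewrite link_ofK.
by right; congr link_of; case: (orientation w) (orientation v) neq => [] [].
Qed.

(** Couple [i] occupies a segment of length [len], and neighbouring segments are [gap] apart; [true]
    marks the left end. *)
Definition endpoint (i : 'I_m) (b : bool) : R^o :=
  i%:R * (len + gap) + (if b then 0 else len).

Definition couple_sender v := endpoint (couple v) (orientation v).
Definition couple_receiver v := endpoint (couple v) (~~ orientation v).

Lemma couple_sender_neq_receiver v : couple_sender v != couple_receiver v.
Proof.
rewrite /couple_sender /couple_receiver /endpoint (inj_eq (addrI _)).
by case: (orientation v); rewrite /= ?[_ == 0]gt_eqF ?lt_eqF.
Qed.

Definition couples : link_set R :=
  @LinkSet R (m + m) R^o couple_sender couple_receiver
    couple_sender_neq_receiver.

Lemma link_length_couples (v : 'I_(nlinks couples)) : link_length v = len.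
Proof.
rewrite /link_length /cross_dist /= /mdist/=.
rewrite /couple_sender /couple_receiver /endpoint.
rewrite opprD addrACA subrr add0r.
by case: (orientation v); rewrite /= ?subr0 ?sub0r ?normrN gtr0_norm.
Qed.

Lemma cross_dist_partner (v : 'I_(nlinks couples)) :
  cross_dist (partner v : 'I_(nlinks couples)) v = 0.
Proof.
rewrite /cross_dist /= /couple_sender /couple_receiver.
by rewrite couple_partner orientation_partner mdistxx.
Qed.

Lemma distant_endpoints (i j : nat) (a b : R) :
  0 <= a <= len -> 0 <= b <= len -> i != j ->
  gap <= `|j%:R * (len + gap) + b - (i%:R * (len + gap) + a)|.
Proof.
move=> /andP[a0 al] /andP[b0 bl]; rewrite neq_ltn => /orP[] h.
  have {h} : 1 <= j%:R - i%:R :> R by rewrite lerBrDl natr1 ler_nat.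
  set x := _ - _ => x1; rewrite ler_normr; apply/orP; left.
  have -> : j%:R * (len + gap) + b - (i%:R * (len + gap) + a) =
      x * (len + gap) + b - a by rewrite /x; ring.
  (* This product makes the goal linear in the monomials; the offsets [b - a] cost at most [len]. *)
  have : 0 <= (x - 1) * (len + gap) by rewrite mulr_ge0 ?subr_ge0// addr_ge0// ltW.
  by clearbody x; lra.
have {h} : 1 <= i%:R - j%:R :> R by rewrite lerBrDl natr1 ler_nat.
set x := _ - _ => x1; rewrite ler_normr; apply/orP; right.
have -> : - (j%:R * (len + gap) + b - (i%:R * (len + gap) + a)) =
    x * (len + gap) + a - b by rewrite /x; ring.
have : 0 <= (x - 1) * (len + gap) by rewrite mulr_ge0 ?subr_ge0// addr_ge0// ltW.
by clearbody x; lra.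
Qed.

Lemma cross_dist_far (v w : 'I_(nlinks couples)) :
  couple w != couple v -> gap <= cross_dist w v.
Proof.
move=> wv; rewrite /cross_dist /= /mdist/=.
apply: distant_endpoints => //.
- by case: orientation; rewrite !lexx ltW.
- by case: orientation; rewrite !lexx ltW.
Qed.

End couples.

(** * The scheduling number of the couples *)

Section couples_schedule.
Context {R : realType} {alpha beta noise : R} {m : nat} {len gap p : R}.
Hypotheses (alpha_gt0 : 0 < alpha) (beta_gt0 : 0 < beta).
Hypotheses (noise_ge0 : 0 <= noise) (m_gt0 : (0 < m)%N).
Hypotheses (len_gt0 : 0 < len) (gap_gt0 : 0 < gap) (p_gt0 : 0 < p).
Local Notation L := (couples m len gap len_gt0).
Local Notation power := (fun _ : 'I_(nlinks L) => p).
Implicit Types (v : 'I_(nlinks L)) (S : {set 'I_(nlinks L)}).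

Lemma partner_not_succeeds S v : partner m v \in S ->
  ~~ succeeds alpha beta noise power S v.
Proof.
move=> pS.
apply: (@colocated_not_succeeds _ _ _ _ L power _ _ _ _ _ _ (partner m v)) => //.
- exact: partner_neq.
- exact: cross_dist_partner.
Qed.

Hypothesis far_apart :
  beta * ((m + m)%:R * (p / gap `^ alpha) + noise) <= p / len `^ alpha.

(** Only one link of each couple is left, so every interferer is at least [gap] away and [far_apart]
    controls the total. *)
Lemma orientation_feasible b :
  feasible alpha beta noise power [set v | orientation m v == b]%SET.
Proof.
apply/forall_inP => v vS.
apply: (@far_succeeds R alpha beta noise L power _ _ _ (p / gap `^ alpha)) => //.
- by rewrite link_length_couples.
- move=> w; rewrite !inE in vS * => wb wv.
  have gd : gap <= cross_dist w v.
    apply: cross_dist_far => //; apply/eqP => /same_couple[wE|wE].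
      by rewrite wE eqxx in wv.
    by move: wb; rewrite wE orientation_partner -(eqP vS); case: orientation.
  split; first exact: lt_le_trans gd.
  rewrite ler_pM2l// lef_pV2 ?posrE ?powR_gt0//; last exact: lt_le_trans gd.
  apply: ge0_ler_powR => //; rewrite ?nnegrE ?(ltW alpha_gt0)// ltW//.
  exact: lt_le_trans gd.
- by rewrite divr_ge0 ?powR_ge0// ltW.
- by rewrite link_length_couples.
Qed.

Lemma couples_scheduling_number : is_scheduling_number alpha beta noise power 2.
Proof.
pose A b := [set v : 'I_(nlinks L) | orientation m v == b]%SET.
have i0 : 'I_m := Ordinal m_gt0.
have An0 b : link_of m i0 b \in A b by rewrite inE orientationK.
have Adis : A true != A false.
  apply/eqP => AE; have := An0 true; rewrite AE inE orientationK //.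
split.
  exists [set A true; A false]%SET; last by rewrite cards2 Adis.
  apply/andP; split; last first.
    apply/forall_inP => S; rewrite !inE => /orP[] /eqP->;
      exact: orientation_feasible.
  apply/and3P; split.
  - apply/eqP/setP => v; rewrite inE; apply/finset.bigcupP.
    exists (A (orientation m v)); rewrite !inE//.
    by case: orientation; rewrite eqxx ?orbT.
  - apply/finset.trivIsetP => S S'; rewrite !inE => /orP[] /eqP-> /orP[] /eqP->;
      rewrite ?eqxx// => _; rewrite -finset.setI_eq0; apply/eqP/setP => v;
      by rewrite !inE; case: orientation.
  - rewrite !inE negb_or; apply/andP; split; rewrite eq_sym; apply/set0Pn.
      by exists (link_of m i0 true).
    by exists (link_of m i0 false).
move=> Q /andP[/and3P[/eqP cQ _ _] /forall_inP fQ].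
pose v : 'I_(nlinks L) := link_of m i0 true.
have inQ u : u \in finset.cover Q by rewrite cQ inE.
(* A link and its partner cannot share a feasible block, which forces two blocks. *)
have neq : finset.pblock Q v != finset.pblock Q (partner m v).
  apply/eqP => e; have := fQ _ (finset.pblock_mem (inQ v)).
  move=> /forall_inP/(_ v); rewrite finset.mem_pblock inQ => /(_ isT).
  apply/negP/partner_not_succeeds.
  by rewrite e finset.mem_pblock inQ.
pose B := [set finset.pblock Q v; finset.pblock Q (partner m v)]%SET.
suff : (#|B| <= #|Q|)%N by rewrite cards2 neq.
apply: subset_leq_card; apply/fintype.subsetP => S.
by rewrite !inE => /orP[] /eqP->; exact: finset.pblock_mem.
Qed.

End couples_schedule.

(** * Couples whose seeds yield the same word *)

Section collided_couple.
Context {R : realType} {alpha beta noise : R} {m : nat} {len gap p : R}.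
Hypotheses (alpha_gt0 : 0 < alpha) (beta_gt0 : 0 < beta).
Hypotheses (noise_ge0 : 0 <= noise) (len_gt0 : 0 < len) (p_gt0 : 0 < p).
Context {A : algorithm R} (nhat : nat).
Local Notation L := (couples m len gap len_gt0).
Local Notation power := (fun _ : 'I_(nlinks L) => p).

(** [nseq i false] is the history in slot [i] of a sender without success so far, so the word
    depends on the seed alone. *)
Definition silent_trajectory k (s : seed A) : k.-tuple bool :=
  [tuple transmit nhat s (nseq i false) | i < k].

(** Both histories go through one induction: while both are all negative, equal words make the
    partners transmit or stay silent together, and neither succeeds. *)
Lemma collided_ack_history k (s : 'I_(nlinks L) -> seed A)
    (v : 'I_(nlinks L)) :
  silent_trajectory k (s v) = silent_trajectory k (s (partner m v)) ->
  forall t, (t <= k)%N ->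
  ack_history alpha beta noise power nhat s t v = nseq t false /\
  ack_history alpha beta noise power nhat s t (partner m v) = nseq t false.
Proof.
move=> sE; elim=> [//|t IH tk]; have [Hv Hp] := IH (ltnW tk).
set S := transmitters nhat s (ack_history alpha beta noise power nhat s t).
have Sv : (v \in S) = (partner m v \in S).
  rewrite !inE Hv Hp.
  by have := congr1 (fun x => tnth x (Ordinal tk)) sE; rewrite !tnth_mktuple.
have fail u : (u \in S -> partner m u \in S) ->
    succeeds alpha beta noise power S u = false.
  have [uS /(_ isT) pS|uS _] := boolP (u \in S).
    by apply/negbTE/partner_not_succeeds.
  by rewrite /succeeds (negbTE uS).
rewrite /= -/S Hv Hp !fail ?partnerK ?Sv//.
by split; rewrite -cats1 -[[:: false]]/(nseq 1 false) -nseqD addn1.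
Qed.

Lemma collided_num_slots k (s : 'I_(nlinks L) -> seed A) (v : 'I_(nlinks L)) :
  silent_trajectory k (s v) = silent_trajectory k (s (partner m v)) ->
  (k.+1%:R%:E <= num_slots alpha beta noise power nhat s)%E.
Proof.
move=> sE; apply: le_ereal_inf_tmp => _ [t /= /forallP/(_ v) st <-].
(* A history of length [t <= k] contains no [true], so [k.+1] is the earliest completion time. *)
rewrite lee_fin ler_nat ltnNge; apply/negP => tk; move: st.
by have [-> _] := collided_ack_history _ _ _ sE _ tk; rewrite mem_nseq andbF.
Qed.

Lemma measurable_silent_trajectory k (w : k.-tuple bool) :
  measurable (silent_trajectory k @^-1` [set w]).
Proof.
rewrite (_ : _ @^-1` _ = \bigcap_(i in [set: 'I_k])
    ((fun s : seed A => transmit nhat s (nseq i false)) @^-1` [set tnth w i])).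
  apply: fin_bigcap_measurable; first exact: finite_finset.
  move=> i _; rewrite -[_ @^-1` _]setTI.
  exact: measurable_transmit.
apply/seteqP; split => s /=.
  by move=> <- i _ /=; rewrite tnth_mktuple.
by move=> h; apply: eq_from_tnth => i; rewrite tnth_mktuple; exact: h.
Qed.

End collided_couple.

(** * Expectation and collision bounds *)

Section probability_bounds.
Context {R : realType} {d : measure_display} {T : measurableType d}.
Variable P : probability T R.

(** The integral is a supremum over simple functions below [f], and [r] times the indicator of [A]
    is one of them. Hence the bound applies to [num_slots] without a proof that it is measurable. *)
Lemma ge0_markov (f : T -> \bar R) (A : set T) (r : R) :
  (forall x, 0 <= f x)%E -> measurable A -> 0 <= r ->
  (forall x, A x -> r%:E <= f x)%E -> (r%:E * P A <= \int[P]_x f x)%E.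
Proof.
move=> f0 mA r0 rf; rewrite ge0_integralTE//.
apply: ereal_sup_ubound; exists (scale_nnsfun (indic_nnsfun R mA) r0) => /=.
  move=> x; rewrite /measurable_realfun.mindic indicE; case: (boolP (x \in A)) => xA.
    by rewrite mulr1; apply: rf; rewrite inE in xA.
  by rewrite mulr0.
by rewrite sintegralrM sintegral_indic.
Qed.

Lemma union_bound (I : finType) (Q : pred I) (E : I -> set T) :
  (forall i, measurable (E i)) ->
  measurable (\big[setU/set0]_(i | Q i) E i) /\
  (P (\big[setU/set0]_(i | Q i) E i) <= \sum_(i | Q i) P (E i))%E.
Proof.
move=> mE; elim/big_rec2: _ => [|i x y _ [mx xy]]; first by rewrite measure0.
split; first exact: measurableU.
by apply: (le_trans (measureU2 _ _ _)) => //; rewrite leeD2l.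
Qed.

Variables (W : finType) (f : T -> W).
Hypothesis mf : forall w, measurable (f @^-1` [set w]).

Definition class_prob w : R := fine (P (f @^-1` [set w])).

Lemma class_probE w : P (f @^-1` [set w]) = (class_prob w)%:E.
Proof. by rewrite fineK// fin_num_measure. Qed.

Lemma sum_class_prob : \sum_w class_prob w = 1.
Proof.
apply: EFin_inj; rewrite -sumEFin -(probability_setT P).
under eq_bigr do rewrite -class_probE.
rewrite fsbig_seq ?index_enum_uniq// -measure_fin_bigcup//; last first.
  by move=> i j _ _ [x [/= <- <-]].
congr (P _); apply/seteqP; split => x //= _.
by exists (f x); rewrite /= ?mem_index_enum.
Qed.

(** The left side is the probability that two independent samples fall in different classes; its
    complement is the sum of the squared class probabilities. *)
Lemma class_prob_neq :
  \sum_(xy : W * W | xy.1 != xy.2) class_prob xy.1 * class_prob xy.2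
    <= 1 - #|W|%:R^-1.
Proof.
have sum2 : \sum_(xy : W * W) class_prob xy.1 * class_prob xy.2 = 1.
  rewrite -(pair_bigA _ (fun x y => class_prob x * class_prob y))/=.
  under eq_bigr do rewrite -mulr_sumr sum_class_prob mulr1.
  exact: sum_class_prob.
have diag : \sum_(xy : W * W | xy.1 == xy.2) class_prob xy.1 * class_prob xy.2
    = \sum_w class_prob w ^+ 2.
  rewrite -(pair_big_dep predT (fun x y => x == y)
    (fun x y => class_prob x * class_prob y))/=.
  by apply: eq_bigr => x _; rewrite (big_pred1 x)// => y; rewrite eq_sym.
move: sum2; rewrite (bigID (fun xy => xy.1 == xy.2))/= diag => /eqP.
rewrite eq_sym -subr_eq eq_sym addrC => /eqP sum2.
suff : #|W|%:R^-1 <= \sum_w class_prob w ^+ 2 by lra.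
have W0 : 0 < #|W|%:R :> R.
  rewrite ltr0n lt0n; apply/eqP => W0; have := sum_class_prob.
  rewrite big_pred0 => [/eqP|w]; first by rewrite eq_sym oner_eq0.
  by have := card0_eq W0 w; rewrite !inE.
(* Cauchy-Schwarz, obtained by comparing the class probabilities with the uniform ones. *)
have : 0 <= \sum_w (class_prob w - #|W|%:R^-1) ^+ 2.
  by apply: sumr_ge0 => w _; exact: sqr_ge0.
under eq_bigr do rewrite sqrrB.
rewrite big_split/= sumrB sumrMnl -mulr_suml sum_class_prob mul1r.
rewrite sumr_const -[X in _ + X]mulr_natl expr2 mulrA divff ?gt_eqF// mul1r.
by set x := _^-1; rewrite mulr2n; lra.
Qed.

End probability_bounds.

(** [N] is the event that the two labels differ in every couple, written as a finite union of events
    [E g] fixing the labels of all links. This gives measurability, and independence evaluates each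
    [E g]. *)
Lemma prob_no_collision {R : realType} {A : algorithm R} {m : nat}
    (X : execution A (m + m)) (W : finType) (f : seed A -> W) :
  (forall w, measurable (f @^-1` [set w])) ->
  exists2 N : set (sample X), measurable N &
    (forall o, ~ N o -> exists v : 'I_(m + m),
      f (seeds v o) = f (seeds (partner m v) o)) /\
    (sample_prob X N <= ((1 - #|W|%:R^-1) ^+ m)%:E)%E.
Proof.
move=> mf; pose q := class_prob (seed_law A) W f.
pose lbl (g : {ffun 'I_m -> W * W}) v :=
  if orientation m v then (g (couple m v)).1 else (g (couple m v)).2.
(* Quantifying over the full set matches the form of [mutually_independent]. *)
pose E g : set (sample X) :=
  [set o | forall v, v \in [set: 'I_(m + m)]%SET ->
    (f @^-1` [set lbl g v]) (seeds v o)].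
have mE g : measurable (E g).
  rewrite (_ : E g = \bigcap_(v in [set: 'I_(m + m)])
      (seeds v @^-1` (f @^-1` [set lbl g v]))); last first.
    apply/seteqP; split => o /= h v; first by move=> _; apply: h; rewrite inE.
    by move=> _; exact: h.
  apply: fin_bigcap_measurable; first exact: finite_finset.
  by move=> v _; rewrite -[_ @^-1` _]setTI; exact: measurable_seeds.
have PE g : sample_prob X (E g) = (\prod_i (q (g i).1 * q (g i).2))%:E.
  rewrite /E (@seeds_independent _ _ _ X [set: _]%SET
    (fun v => f @^-1` [set lbl g v]))//.
  rewrite (eq_bigr (fun v => (q (lbl g v))%:E)) => [|v _]; last first.
    by rewrite -class_probE//; exact: seeds_law.
  rewrite prodEFin; congr (_%:E).
  rewrite (eq_bigl xpredT) => [|v]; last by rewrite inE.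
  rewrite big_split_ord/= -big_split/=; apply: eq_bigr => i _.
  rewrite /lbl -[lshift m i]/(link_of m i true).
  rewrite -[rshift m i]/(link_of m i false).
  by rewrite !orientationK !coupleK.
have [mN leN] := @union_bound _ _ _ (sample_prob X) _
  (mem (ffun_on [pred xy : W * W | xy.1 != xy.2])) E mE.
eexists; first exact: mN.
split.
  move=> o No; apply: contrapT => /forallNP neq; apply: No.
  rewrite -bigcup_pred.
  exists [ffun i => (f (seeds (link_of m i true) o),
                     f (seeds (link_of m i false) o))].
    apply/ffun_onP => i; rewrite ffunE inE/=; apply/eqP => e.
    apply: (neq (link_of m i true)); rewrite e /partner.
    by rewrite coupleK orientationK.
  move=> v _ /=; rewrite /lbl ffunE/=.
  by have := link_ofK m v; case: (orientation m v) => ->.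
apply: (le_trans leN).
under eq_bigr do rewrite PE.
(* Distributivity turns the sum over assignments [g] into a product over couples, with each factor
   bounded by [class_prob_neq]. *)
rewrite sumEFin lee_fin -[leLHS](bigA_distr_big
  [pred xy : W * W | xy.1 != xy.2] (fun _ xy => q xy.1 * q xy.2)).
rewrite -[m in leRHS]card_ord -prodr_const.
apply: ler_prod => i _; rewrite class_prob_neq// andbT.
by apply: sumr_ge0 => xy _; rewrite mulr_ge0// fine_ge0.
Qed.

(** * Numerical choices and the final bound *)

Lemma one_minus_inv_expn {R : realType} (n : nat) : (0 < n)%N ->
  (1 - n%:R^-1) ^+ n <= 2^-1 :> R.
Proof.
move=> n0; have n0' : 0 < n%:R :> R by rewrite ltr0n.
have le1 : 0 <= 1 - n%:R^-1 :> R by rewrite subr_ge0 invf_le1// ler1n.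
(* The middle term equals [expR (-1)], and [expR 1] is at least 2. *)
apply: (@le_trans _ _ (expR (- n%:R^-1) ^+ n)).
  by rewrite lerXn2r// ?nnegrE ?expR_ge0// expR_ge1Dx.
rewrite -expRM_natl mulrN divff ?gt_eqF// expRN lef_pV2 ?posrE ?expR_gt0//.
exact: expR_ge1Dx.
Qed.

Lemma separating_gap {R : realType} (alpha beta noise p q : R) (n : nat) :
  0 < alpha -> 0 < beta -> 0 < p -> (0 < n)%N -> beta * noise < q ->
  exists2 gap : R, 0 < gap &
    beta * (n%:R * (p / gap `^ alpha) + noise) <= q.
Proof.
move=> a0 b0 p0 n0 bq.
have n0' : 0 < n%:R :> R by rewrite ltr0n.
have d0 : 0 < q - beta * noise by rewrite subr_gt0.
(* [K] is the value of the attenuation at distance [gap] that turns the bound into an equality. *)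
pose K := beta * (n%:R * p) / (q - beta * noise).
have K0 : 0 < K by rewrite divr_gt0// mulr_gt0// mulr_gt0.
exists (K `^ alpha^-1); first exact: powR_gt0.
rewrite -powRrM mulVf ?gt_eqF// (powRr1 (ltW K0)) /K.
set x := (X in X <= _); suff -> : x = q by [].
rewrite /x; field.
by rewrite !gt_eqF.
Qed.

Lemma couples_expected_slots {R : realType} (alpha beta noise len gap p : R)
    (len_gt0 : 0 < len) (k : nat) (A : algorithm R) (nhat : nat)
    (X : execution A (nlinks (couples (2 ^ k) len gap len_gt0))) :
  0 < alpha -> 0 < beta -> 0 <= noise -> 0 < p ->
  ((k.+1%:R / 2)%:E <=
    expected_slots alpha beta noise (fun=> p) nhat X)%E.
Proof.
move=> a0 b0 noise0 p0.
have [N mN [collide PN]] := prob_no_collision X _ _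
  (measurable_silent_trajectory nhat k).
apply: (@le_trans _ _ (k.+1%:R%:E * sample_prob X (~` N))%E).
  rewrite EFinM lee_pmul2l// ?lte_fin ?ltr0n// probability_setC//.
  rewrite leeBrDr ?fin_num_measure//.
  apply: (@le_trans _ _ (2^-1%:E + 2^-1%:E)%E).
    (* There are [2 ^ k] words, exactly as many as couples. *)
    rewrite leeD2l// (le_trans PN)// lee_fin card_tuple card_bool.
    by apply: one_minus_inv_expn; rewrite expn_gt0.
  by rewrite -EFinD lee_fin; lra.
apply: ge0_markov => //.
- by move=> o; apply: le_ereal_inf_tmp => _ [t _ <-]; rewrite lee_fin.
- exact: measurableC.
- by move=> o /collide [v]; exact: collided_num_slots.
Qed.

Theorem theorem2 (R : realType) (alpha beta noise : R)
    (alpha_gt0 : 0 < alpha) (beta_ge1 : 1 <= beta) (noise_ge0 : 0 <= noise) :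
  exists2 c : R, 0 < c &
  forall (P : R -> R),
    (forall l : R, 0 < l -> 0 < P l) ->
    (exists2 l : R, 0 < l & beta * noise < P l / l `^ alpha) ->
  forall (A : algorithm R) (n0 : nat),
  exists (L : link_set R) (T : nat),
    let power := fun v : 'I_(nlinks L) => P (link_length v) in
    [/\ (n0 <= nlinks L)%N,
        is_scheduling_number alpha beta noise power T &
        forall (nhat : nat) (X : execution A (nlinks L)),
          ((c * ln (nlinks L)%:R * T%:R)%:E
            <= expected_slots alpha beta noise power nhat X)%E].
Proof.
have beta_gt0 : 0 < beta by exact: lt_le_trans beta_ge1.
(* With [2 ^ k.+1] links, [T = 2] and [ln 2 <= 1], the factor [4^-1] brings the bound below
   [k.+1 / 2]. The required size [n0] itself serves as [k]. *)
exists 4^-1 => // P P_gt0 [len len_gt0 strong] A k.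
have m_gt0 : (0 < 2 ^ k)%N by rewrite expn_gt0.
have [gap gap_gt0 far_apart] := separating_gap alpha beta noise _ _
  (2 ^ k + 2 ^ k) alpha_gt0 beta_gt0 (P_gt0 _ len_gt0) (ltn_addl _ m_gt0) strong.
exists (couples (2 ^ k) len gap len_gt0), 2; move=> power.
(* All links have length [len], so any length-based power assignment is uniform here. *)
have -> : power = fun=> P len.
  by apply/funext => v; rewrite /power link_length_couples.
split.
- by rewrite /= addnn -mul2n -expnS ltnW// (ltn_trans (ltnSn _))// ltn_expl.
- by apply: couples_scheduling_number => //; exact: P_gt0.
move=> nhat X; apply: le_trans; last first.
  by apply: couples_expected_slots => //; exact: P_gt0.
rewrite lee_fin /= addnn -mul2n -expnS natrX lnXn// -mulr_natr.
have : ln 2 <= 1 :> R.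
  by rewrite -[leRHS]expRK ler_ln ?posrE ?expR_gt0// expR_ge1Dx.
have : 0 < k.+1%:R :> R by rewrite ltr0n.
by nra.
Qed.
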